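(* Let $n\ge1$. For $0<\alpha<1$, let $\tilde{C}_S(\alpha)$ and $C_S(\alpha)$ denote the Tauberian constants with respect to $\alpha$ associated with the discrete strong maximal operator $\tilde{M}_S$ on $\mathbb{Z}^n$ and the continuous strong maximal operator $M_S$ on $\mathbb{R}^n$, respectively. Then $$\tilde{C}_S(\alpha)=C_S(\alpha).$$
   Context: Discrete strong maximal operator: for $f$ on $\mathbb{Z}^n$ and $m\in\mathbb{Z}^n$, $$\tilde{M}_Sf(m)=\sup_{R\ni0}\frac{1}{\#(R\cap\mathbb{Z}^n)}\sum_{j\in R\cap\mathbb{Z}^n}|f(m+j)|,$$ where the supremum is over all open rectangles (rectangular parallelepipeds) $R\subset\mathbb{R}^n$ containing the origin with sides parallel to the coordinate axes, and $$\tilde{C}_S(\alpha)=\sup_{E\subset\mathbb{Z}^n,\ 0<\#E<\infty}\frac{1}{\#E}\#\{m\in\mathbb{Z}^n: \tilde{M}_S\chi_E(m)>\alpha\}.$$ Continuous strong maximal operator: for $x\in\mathbb{R}^n$, $$M_Sf(x)=\sup_{R\ni x}\frac{1}{|R|}\int_R|f|,$$ where the supremum is over all open rectangles in $\mathbb{R}^n$ containing $x$ with sides parallel to the coordinate axes, and $$C_S(\alpha)=\sup_{E\subset\mathbb{R}^n\text{ measurable},\ 0<|E|<\infty}\frac{1}{|E|}|\{x\in\mathbb{R}^n: M_S\chi_E(x)>\alpha\}|.$$ Here $|\cdot|$ is Lebesgue measure, $\chi_E$ is the indicator function of $E$ and $\#$ denotes cardinality. *)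

(* Defs.v *)
From HB Require Import structures.
From mathcomp Require Import all_boot all_order all_algebra.
From mathcomp Require Import all_classical all_reals all_analysis.

Set Implicit Arguments.
Unset Strict Implicit.
Unset Printing Implicit Defensive.

Import Order.TTheory GRing.Theory Num.Theory.

Local Open Scope classical_set_scope.
Local Open Scope ring_scope.
Local Open Scope ereal_scope.

Section LebesgueMeasure.
Context (R : realType).
Local Notation RT := (measurableTypeR R).

Definition tuple_of_pair n (p : n.-tuple RT * RT) : n.+1.-tuple RT :=
  [the n.+1.-tuple RT of p.2 :: p.1].

Lemma measurable_tuple_of_pair n : measurable_fun [set: _] (@tuple_of_pair n).
Proof. exact: measurable_cons. Qed.

(* The n-fold product of the Lebesgue measure of R, on Borel sets of R^n. The
   long identifier is the measure structure that MathComp-Analysis puts on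
   [pushforward mu f]; it is named here because the measurability of [f], its
   second argument, is not inferred. *)
Fixpoint borel_lebesgue n : {measure set (n.-tuple RT) -> \bar R} :=
  if n is n'.+1 then
    measure_function_pushforward__canonical__measure_function_Measure
      (product_measure1 (borel_lebesgue n') (@lebesgue_measure R))
      (@measurable_tuple_of_pair n')
  else \d_ [tuple].

(* R^n with the sigma-algebra of Lebesgue measurable sets, i.e. the
   Caratheodory measurable sets of the Lebesgue outer measure. *)
Definition Rn n : measurableType _ := caratheodory_type (borel_lebesgue n)^*%mu.

(* Defined on all sets as the outer measure; a complete measure on [Rn n]. *)
Definition lebesgue_Rn n : set (Rn n) -> \bar R :=
  @completed_measure_extension _ _ _ (borel_lebesgue n).
HB.instance Definition _ n := Measure.on (@lebesgue_Rn n).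

End LebesgueMeasure.

Section StrongMaximal.
Context (R : realType) (n : nat).
Local Notation card E := (@counting 'rV[int]_n R E).
Implicit Types (a b : n.-tuple R) (Q : set (Rn R n)) (alpha : R).

Definition open_box a b : set (Rn R n) :=
  [set x | forall i : 'I_n, (tnth a i < tnth x i < tnth b i)%R].

(* The empty rectangle is not excluded: it never contains the point that the
   maximal operators require. *)
Definition open_rectangle : set (set (Rn R n)) :=
  [set Q | exists a b, Q = open_box a b].

Definition strong_maximal (f : Rn R n -> R) (x : Rn R n) : \bar R :=
  ereal_sup [set (lebesgue_Rn Q)^-1 *
                 \int[@lebesgue_Rn R n]_(y in Q) `|f y|%:E
            | Q in [set Q | open_rectangle Q /\ Q x]].

Definition tauberian alpha : \bar R :=
  ereal_sup [set (lebesgue_Rn E)^-1 *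
                 lebesgue_Rn [set x | alpha%:E < strong_maximal \1_E x]
            | E in [set E | measurable E /\ 0 < lebesgue_Rn E < +oo]].

Definition Rn_of_int (m : 'rV[int]_n) : Rn R n :=
  [tuple (m ord0 i)%:~R%R | i < n].

Definition lattice_points Q : set 'rV[int]_n := [set j | Q (Rn_of_int j)].

Definition discrete_strong_maximal (f : 'rV[int]_n -> R) (m : 'rV[int]_n)
    : \bar R :=
  ereal_sup [set (card (lattice_points Q))^-1 *
                 \esum_(j in lattice_points Q) `|f (m + j)%R|%:E
            | Q in [set Q | open_rectangle Q /\ Q (Rn_of_int 0)]].

Definition discrete_tauberian alpha : \bar R :=
  ereal_sup [set (card E)^-1 *
                 card [set m | alpha%:E < discrete_strong_maximal \1_E m]
            | E in [set E : set 'rV[int]_n | 0 < card E < +oo]].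

End StrongMaximal.

(* Main.v *)
Require Import Defs.
From mathcomp Require Import all_boot all_order all_algebra.
From mathcomp Require Import finmap zify lra.
From mathcomp Require Import all_classical all_reals all_analysis.

(** A finite set E of lattice points is compared with the union of the open
    unit cells m + (0,1)^n, m in E: after rounding outwards to integer corners,
    a rectangle has the same E-average in both settings.  Conversely, a
    rectangle with continuous average > alpha is exhausted from inside by
    rectangles with dyadic corners, so the level set is an increasing union of
    sets H_k, each a union of dyadic rectangles of level k contained in a fixed
    window on which the average exceeds alpha with a gap 2^-k.  For fixed k, E
    is approximated on the window, up to less than 2^-k, by a finite union of
    dyadic cells of a finer level j; rescaled by 2^j, that union is a finite
    set of lattice points for which every rectangle making up H_k is still
    good, hence |H_k| <= C |E| with C the discrete constant. *)

Set Implicit Arguments.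
Unset Strict Implicit.
Unset Printing Implicit Defensive.

Import Order.TTheory GRing.Theory Num.Theory.

Local Open Scope classical_set_scope.
Local Open Scope ring_scope.
Local Open Scope ereal_scope.

(** * Cardinalities as sums and as measures of unions of cells *)

Section Counting.
Context {R : realType} {T : choiceType}.
Implicit Types A B : set T.

Lemma counting_ge0 A : 0 <= counting A :> \bar R.
Proof. by rewrite /counting; case: ifPn; rewrite ?lee_fin ?leey. Qed.

Lemma counting_finite A : finite_set A ->
  counting A = (#|` fset_set A|)%:R%:E :> \bar R.
Proof. by move=> fA; rewrite /counting asboolT. Qed.

Lemma counting_infinite A : infinite_set A -> counting A = +oo :> \bar R.
Proof. by move=> iA; rewrite /counting asboolF. Qed.

Lemma le_counting A B : A `<=` B -> counting A <= counting B :> \bar R.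
Proof.
move=> AB; have [fB|iB] := pselect (finite_set B); last first.
  by rewrite (counting_infinite iB) leey.
have fA := sub_finite_set AB fB.
rewrite !counting_finite// lee_fin ler_nat fsubset_leq_card//.
by rewrite -fset_set_sub.
Qed.

Lemma counting_fset (B : {fset T}) :
  counting [set` B] = (#|` B|)%:R%:E :> \bar R.
Proof. by rewrite counting_finite// set_fsetK. Qed.

(** Written as a sum, the cardinality inherits reindexing along injections and restriction to
    indicators. If [A] is infinite, its finite subsets with more than [r] elements push the sum
    above every real [r]. *)
Lemma counting_esum A : counting A = \esum_(i in A) 1 :> \bar R.
Proof.
have fin B : finite_set B -> counting B = \esum_(i in B) 1 :> \bar R.
  move=> fB; rewrite esum_fset// fsbig_finite// counting_finite//.
  by rewrite sumEFin big_const_seq iter_addr_0 count_predT.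
have [/fin//|iA] := pselect (finite_set A).
rewrite counting_infinite//; apply/esym/eqyP => r r0.
have [B BA rB] := infinite_set_fset (Num.trunc r).+1 iA.
apply: esum_ge; exists [set` B]; first by split.
rewrite fsbig_finite// sumEFin big_const_seq iter_addr_0 count_predT.
rewrite set_fsetK lee_fin.
by rewrite (le_trans (ltW (truncnS_gt r)))// ler_nat.
Qed.

Lemma esum_indic A B :
  \esum_(i in A) (\1_B i)%:E = counting (A `&` B) :> \bar R.
Proof.
rewrite counting_esum esum_mkcondr; apply: eq_esum => i _.
by rewrite indicE; case: ifP.
Qed.

End Counting.

Lemma counting_image {R : realType} {T U : choiceType} (f : T -> U)
    (A : set T) : injective f -> counting (f @` A) = counting A :> \bar R.
Proof. by move=> fI; rewrite !counting_esum esum_image// => x y _ _ /fI. Qed.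

(** Additivity handles finite [A]. An infinite [A] contains finite sets of arbitrarily large
    cardinality, and [0 < c] then makes both sides [+oo]. *)
Lemma measure_bigcup_cst d (T : measurableType d) (R : realType)
    (mu : {measure set T -> \bar R}) (I : countType) (C : I -> set T) (c : R)
    (A : set I) :
  (0 < c)%R -> trivIset setT C -> (forall i, measurable (C i)) ->
  (forall i, mu (C i) = c%:E) ->
  mu (\bigcup_(i in A) C i) = c%:E * counting A.
Proof.
move=> c0 tC mC muC.
have fin (B : set I) : finite_set B ->
    mu (\bigcup_(i in B) C i) = c%:E * counting B.
  move=> fB; rewrite measure_fin_bigcup//; last exact: sub_trivIset tC.
  rewrite (eq_fsbigr (fun=> c%:E)) => [|i _]; last exact: muC.
  rewrite fsbig_finite// counting_finite//.
  by rewrite sumEFin big_const_seq iter_addr_0 count_predT -EFinM mulr_natr.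
have [/fin//|iA] := pselect (finite_set A).
rewrite counting_infinite// gt0_muley ?lte_fin//; apply/eqyP => r r0.
have [B BA rB] := infinite_set_fset (Num.trunc (r / c)).+1 iA.
have mU (D : set I) : measurable (\bigcup_(i in D) C i).
  rewrite bigcup_mkcond.
  by apply: countable_bigcupT_measurable => // i; case: ifP.
apply: (@le_trans _ _ (mu (\bigcup_(i in [set` B]) C i))); last first.
  by apply: le_measure; rewrite ?inE//; exact: bigcup_subset.
rewrite fin// counting_fset -EFinM lee_fin -ler_pdivrMl// mulrC.
by rewrite (le_trans (ltW (truncnS_gt _)))// ler_nat.
Qed.

(** * Approximation by a family of sets on a window of finite measure *)

Definition approximable d (T : measurableType d) (R : realType)
    (mu : set T -> \bar R) (F : set (set T)) (W : set T) : set (set T) :=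
  [set A | measurable A /\ forall e : R, (0 < e)%R ->
    exists2 B, F B & mu ((A `+` B) `&` W) < e%:E].

(** Errors add up under finite unions. For a countable union, the points of [W] that the first [n]
    sets miss decrease to the empty set; as [W] has finite measure, continuity from above makes them
    cost less than [e / 2] for some [n]. *)
Lemma approximable_sigma_algebra d (T : measurableType d) (R : realType)
    (mu : {measure set T -> \bar R}) (F : set (set T)) (W : set T) :
  F `<=` measurable -> setC_closed F -> setU_closed F -> F set0 ->
  measurable W -> mu W < +oo ->
  sigma_algebra setT (approximable mu F W).
Proof.
move=> FM FC FU F0 mW Woo.
have mY (A B : set T) : measurable A -> measurable B -> measurable (A `+` B).
  by move=> mA mB; apply: measurableU; exact: measurableD.
have aC A : approximable mu F W A -> approximable mu F W (~` A).
  move=> [mA aA]; split=> [|e /aA[B FB AB]]; first exact: measurableC.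
  exists (~` B); first exact: FC.
  suff -> : ~` A `+` ~` B = A `+` B by [].
  by rewrite /setY/= !setDE !setCK setUC (setIC B) (setIC A).
have aU A A' : approximable mu F W A -> approximable mu F W A' ->
    approximable mu F W (A `|` A').
  move=> [mA aA] [mA' aA']; split=> [|e e0]; first exact: measurableU.
  have e20 : (0 < e / 2)%R by rewrite divr_gt0.
  have [B FB AB] := aA _ e20; have [B' FB' AB'] := aA' _ e20.
  exists (B `|` B'); first exact: FU.
  rewrite [e]splitr EFinD.
  apply: le_lt_trans (lteD AB AB').
  apply: le_trans (measureU2 _ _ _).
  - apply: le_measure; rewrite ?inE.
    + apply: measurableI => //.
      by apply: mY; apply: measurableU => //; exact: FM.
    + apply: measurableU; apply: measurableI => //.
        by apply: mY => //; exact: FM.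
      by apply: mY => //; exact: FM.
    + by move=> x; rewrite /setY/=; tauto.
  - by apply: measurableI => //; apply: mY => //; exact: FM.
  - by apply: measurableI => //; apply: mY => //; exact: FM.
split.
- split=> // e e0; exists set0 => //.
  by rewrite setYK set0I measure0 lte_fin.
- by move=> A; rewrite setTD; exact: aC.
move=> A aA.
pose U n := \bigcup_(i < n) A i.
have aUn n : approximable mu F W (U n).
  elim: n => [|n IH]; last first.
    by rewrite /U bigcup_mkord big_ord_recr/= -bigcup_mkord; exact: aU.
  rewrite /U bigcup_mkord big_ord0; split=> // e e0; exists set0 => //.
  by rewrite setYK set0I measure0 lte_fin.
have mA i : measurable (A i) by case: (aA i).
have mU : measurable (\bigcup_i A i) by exact: bigcupT_measurable.
split=> // e e0.
have e20 : (0 < e / 2)%R by rewrite divr_gt0.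
have : mu (((\bigcup_i A i) `\` U n) `&` W) @[n --> \oo] --> mu set0.
  have -> : set0 = \bigcap_n (((\bigcup_i A i) `\` U n) `&` W).
    apply/esym; rewrite -subset0 => x /= h.
    have [[[i _ Aix] _] _] := h 0%N I.
    by have [[_ +] _] := h i.+1 I; apply; exists i => //=.
  have m n : measurable ((\bigcup_i A i `\` U n) `&` W).
    by apply: measurableI => //; apply: measurableD => //; case: (aUn n).
  apply: (@nonincreasing_cvg_mu _ _ _ mu) => //.
  - apply: le_lt_trans Woo; apply: le_measure; rewrite ?inE//; exact: subIsetr.
  - exact: bigcapT_measurable.
  - move=> n p np; apply/subsetPset => x [[Ax Ux] Wx]; split=> //; split=> //.
    by move=> [i /= ni Aix]; apply: Ux; exists i => //=; exact: leq_trans np.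
rewrite measure0 => h.
have /filter_ex[n hn] : \forall n \near \oo,
    mu (((\bigcup_i A i) `\` U n) `&` W) < (e / 2)%:E.
  apply: (h [set y | y < (e / 2)%:E]); apply: open_nbhs_nbhs.
  by split; [exact: open_ereal_lt_ereal|rewrite /= lte_fin].
have [mUn /(_ _ e20)[B FB UB]] := aUn n.
exists B => //; rewrite [e]splitr EFinD.
apply: le_lt_trans (lteD hn UB).
apply: le_trans (measureU2 _ _ _).
- apply: le_measure; rewrite ?inE.
  + by apply: measurableI => //; apply: mY => //; exact: FM.
  + apply: measurableU; apply: measurableI => //; first exact: measurableD.
    by apply: mY => //; exact: FM.
  + move=> x [[[Ax Bx]|[Bx Ax]] Wx].
      have [Ux|Ux] := pselect (U n x); first by right; split=> //; left.
      by left.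
    right; split=> //; right; split=> // -[i _ ?]; apply: Ax; by exists i.
- by apply: measurableI => //; exact: measurableD.
- by apply: measurableI => //; apply: mY => //; exact: FM.
Qed.

(** * Lebesgue measure of products, and Borel outer approximation *)

Section LebesgueRn.
Context {R : realType}.
Local Notation RT := (measurableTypeR R).

Lemma measurable_forall_tnth n (A : 'I_n -> set RT) :
  (forall i, measurable (A i)) ->
  measurable [set x : n.-tuple RT | forall i, A i (tnth x i)].
Proof.
move=> mA.
have -> : [set x : n.-tuple RT | forall i, A i (tnth x i)] =
    \bigcap_i ((fun x : n.-tuple RT => tnth x i) @^-1` A i).
  by apply/seteqP; split => x /=; [move=> h i _; exact: h|move=> h i; exact: h].
apply: fin_bigcap_measurable => // i _.
by rewrite -[X in measurable X]setTI; exact: measurable_tnth.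
Qed.

(** [tuple_of_pair] puts the newest factor at the head, so peeling off coordinate [ord0] leaves a
    rectangle of the product measure. *)
Lemma borel_lebesgue_prod n (A : 'I_n -> set RT) (r : 'I_n -> R) :
  (forall i, measurable (A i)) ->
  (forall i, lebesgue_measure (A i) = (r i)%:E) ->
  borel_lebesgue R n [set x : n.-tuple RT | forall i, A i (tnth x i)] =
  (\prod_(i < n) r i)%:E.
Proof.
elim: n A r => [|n IH] A r.
  move=> _ _; rewrite big_ord0 /= diracE.
  have -> // : [tuple] \in [set x : 0.-tuple RT | forall i, A i (tnth x i)].
  by apply/mem_set => -[].
move=> mA Ar; rewrite big_ord_recl /=.
rewrite /pushforward /=.
have -> : (@tuple_of_pair R n) @^-1` [set x | forall i, A i (tnth x i)] =
    [set x : n.-tuple RT | forall i, A (lift ord0 i) (tnth x i)] `*` A ord0.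
  apply/seteqP; split => -[x t] /=.
    move=> h; split; last by have := h ord0; rewrite tnth0.
    by move=> i; have := h (lift ord0 i); rewrite tnthS.
  move=> [h h0] i; case: (unliftP ord0 i) => [j|] ->.
    by rewrite tnthS.
  by rewrite tnth0.
rewrite product_measure1E//; last first.
  exact: (@measurable_forall_tnth n (fun i => A (lift ord0 i))).
by rewrite (IH (A \o lift ord0) (r \o lift ord0))//= Ar -EFinM mulrC.
Qed.

Lemma measurable_Rn n (A : set (n.-tuple RT)) :
  measurable A -> measurable (A : set (Rn R n)).
Proof. exact: caratheodory_measurable_mu_ext. Qed.

Lemma lebesgue_RnE n (A : set (n.-tuple RT)) : measurable A ->
  lebesgue_Rn A = borel_lebesgue R n A.
Proof. exact: measurable_mu_extE. Qed.

Lemma le_lebesgue_Rn n (A B : set (Rn R n)) : A `<=` B ->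
  lebesgue_Rn A <= lebesgue_Rn B.
Proof. exact: (@le_mu_ext _ _ _ (borel_lebesgue R n)). Qed.

(** The outer measure is an infimum over countable covers by Borel sets; [B] is the union of a
    nearly optimal cover. *)
Lemma lebesgue_Rn_outer n (E : set (Rn R n)) (e : R) :
  lebesgue_Rn E < +oo -> (0 < e)%R ->
  exists B : set (n.-tuple RT),
    [/\ measurable B, E `<=` B & lebesgue_Rn B < lebesgue_Rn E + e%:E].
Proof.
move=> Eoo e0.
have Efin : lebesgue_Rn E \is a fin_num by rewrite ge0_fin_numE.
have [_ [A [mA EA] <-] lt] := lb_ereal_inf_adherent e0 Efin.
exists (\bigcup_k A k); split => //; first exact: bigcupT_measurable.
apply: le_lt_trans lt; rewrite lebesgue_RnE; last exact: bigcupT_measurable.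
by apply: measure_sigma_subadditive => //; exact: bigcupT_measurable.
Qed.

End LebesgueRn.

(** * Integer parts under doubling *)

Section Floor.
Context {R : realType}.
Implicit Types s t : R.

Lemma floor_double s :
  (2 * Num.floor s <= Num.floor (2 * s) < 2 * Num.floor s + 2)%R.
Proof.
rewrite floor_ge_int floor_lt_int intrD intrM.
have /andP[] := floor_itv s; rewrite intrD.
by move=> *; apply/andP; split; lra.
Qed.

Lemma floor_half s : Num.floor s = (Num.floor (2 * s) %/ 2)%Z.
Proof. by have := floor_double s; lia. Qed.

Lemma floor_lt_inv s t : (Num.floor s < Num.floor t)%R -> (s < t)%R.
Proof.
rewrite floor_lt_int => /lt_le_trans; apply.
by have /andP[] := floor_itv t.
Qed.

Lemma floor_double_lt s t : (Num.floor s < Num.floor t)%R ->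
  (Num.floor (2 * s) < Num.floor (2 * t))%R.
Proof. by have := floor_double s; have := floor_double t; lia. Qed.

Lemma near_floor_lt s t : (s < t)%R ->
  \forall k \near \oo, (Num.floor (2 ^+ k * s) < Num.floor (2 ^+ k * t))%R.
Proof.
move=> st; near=> k.
(* Scaled numbers more than 1 apart have different floors. *)
have : (1 < 2 ^+ k * (t - s))%R.
  rewrite -ltr_pdivrMr ?subr_gt0// mul1r; apply: upper_nthrootP.
  by near: k; exact: nbhs_infty_ge.
rewrite -lezD1 floor_ge_int intrD => h.
have /andP[h1 _] := floor_itv (2 ^+ k * s).
by lra.
Unshelve. all: by end_near. Qed.

End Floor.

(** * Dyadic cells and the boxes made of them *)

Section Grid.
Context {R : realType} {n : nat}.
Local Notation RT := (measurableTypeR R).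
Implicit Types (k j : nat) (x y : Rn R n) (m p q : 'rV[int]_n)
  (S : set 'rV[int]_n).

(* The index of the half-open dyadic cell of side [2^-k] that contains [x]. *)
Definition grid k x : 'rV[int]_n :=
  \row_i Num.floor (2 ^+ k * tnth x i : R)%R.

(* Both bounds are strict, so that integer boxes are exactly the lattice points
   of open rectangles, at every scale. *)
Definition int_box p q : set 'rV[int]_n :=
  [set m | forall i, (p ord0 i < m ord0 i < q ord0 i)%R].

Lemma gridS k x : grid k x = \row_i (grid k.+1 x ord0 i %/ 2)%Z.
Proof. by apply/rowP => i; rewrite !mxE floor_half exprS mulrA. Qed.

(** The index at level [k] is a function of the index at level [j]: halve and round down, [j - k]
    times. *)
Lemma grid_refine k j S : (k <= j)%N ->
  exists S', grid k @^-1` S = grid j @^-1` S'.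
Proof.
elim: j => [|j IH]; first by rewrite leqn0 => /eqP ->; exists S.
rewrite leq_eqVlt => /predU1P[->|]; first by exists S.
rewrite ltnS => /IH[S' ->].
exists [set m | S' (\row_i (m ord0 i %/ 2)%Z)].
by apply/seteqP; split => x /=; rewrite (gridS j).
Qed.

Lemma grid_refine_box k j p q : (k <= j)%N -> exists p' q',
  grid k @^-1` int_box p q = grid j @^-1` int_box p' q'.
Proof.
elim: j => [|j IH]; first by rewrite leqn0 => /eqP ->; exists p, q.
rewrite leq_eqVlt => /predU1P[->|]; first by exists p, q.
rewrite ltnS => /IH[p' [q' ->]].
(* Each cell splits in two along every axis: a child index exceeds [2 * p' + 1] exactly when its
   parent exceeds [p'], and is below [2 * q'] exactly when its parent is below [q']. *)
exists (\row_i (2 * p' ord0 i + 1)%R), (\row_i (2 * q' ord0 i)%R).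
by apply/seteqP; split => x /= h i; have := h i; rewrite !mxE exprS -mulrA;
  have := floor_double (2 ^+ j * tnth x i)%R; lia.
Qed.

(** Dyadic exhaustion of the open box from inside: the cells strictly between those of the corners
    cannot touch its boundary. *)
Definition inner_box (a b : Rn R n) k : set (Rn R n) :=
  grid k @^-1` int_box (grid k a) (grid k b).

Lemma inner_boxS (a b : Rn R n) k : inner_box a b k `<=` inner_box a b k.+1.
Proof.
move=> x /= h i; have := h i; rewrite !mxE !exprS -!mulrA.
by move=> /andP[h1 h2]; rewrite !floor_double_lt.
Qed.

Lemma inner_box_sub (a b : Rn R n) k : inner_box a b k `<=` open_box a b.
Proof.
move=> x h i; have := h i; rewrite !mxE.
have p2 : (0 < 2 ^+ k :> R)%R by rewrite exprn_gt0.
by move=> /andP[/floor_lt_inv + /floor_lt_inv]; rewrite !ltr_pM2l// => -> ->.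
Qed.

Lemma near_inner_box (a b : Rn R n) x : open_box a b x ->
  \forall k \near \oo, inner_box a b k x.
Proof.
move=> abx; apply: filter_forall => i.
have /andP[ax xb] := abx i.
near=> k; rewrite !mxE; apply/andP; split; near: k; exact: near_floor_lt.
Unshelve. all: by end_near. Qed.

Lemma bigcup_inner_box (a b : Rn R n) :
  \bigcup_k inner_box a b k = open_box a b.
Proof.
apply/seteqP; split => x; first by move=> [k _]; exact: inner_box_sub.
by move=> /near_inner_box/filter_ex[k]; exists k.
Qed.

End Grid.

(** * Volumes of boxes and of unions of cells *)

Section GridMeasure.
Context {R : realType} {n : nat}.
Local Notation RT := (measurableTypeR R).
Local Notation Tn := (n.-tuple RT).
Implicit Types (k : nat) (m p q : 'rV[int]_n) (S : set 'rV[int]_n).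

Lemma lebesgue_Rn_prod (A : 'I_n -> set RT) (r : 'I_n -> R) :
  (forall i, measurable (A i)) ->
  (forall i, lebesgue_measure (A i) = (r i)%:E) ->
  lebesgue_Rn ([set x | forall i, A i (tnth x i)] : set (Rn R n)) =
  (\prod_(i < n) r i)%:E.
Proof.
move=> mA Ar; rewrite lebesgue_RnE; last first.
  exact: measurable_forall_tnth mA.
exact: borel_lebesgue_prod.
Qed.

Lemma open_box_prod (a b : Rn R n) :
  open_box a b = [set x | forall i, `]tnth a i, tnth b i[%classic (tnth x i)].
Proof. by apply/seteqP; split => x h i; have := h i; rewrite /= in_itv. Qed.

Lemma measurable_open_box (a b : Rn R n) : measurable (open_box a b : set Tn).
Proof.
rewrite open_box_prod; apply: (@measurable_forall_tnth _ _ (fun i => _)) => i.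
exact: measurable_itv.
Qed.

Lemma lebesgue_open_box (a b : Rn R n) : (forall i, tnth a i < tnth b i)%R ->
  lebesgue_Rn (open_box a b) = (\prod_(i < n) (tnth b i - tnth a i))%:E.
Proof.
move=> ab; rewrite open_box_prod; apply: (@lebesgue_Rn_prod (fun i => _)) => i.
  exact: measurable_itv.
by rewrite lebesgue_measure_itv/= lte_fin ab EFinB.
Qed.

Lemma grid_cell k m : grid k @^-1` [set m] =
  [set x : Rn R n | forall i,
    `[((m ord0 i)%:~R / 2 ^+ k)%R,
      (((m ord0 i)%:~R + 1) / 2 ^+ k)%R[%classic (tnth x i)].
Proof.
have p2 : (0 < 2 ^+ k :> R)%R by rewrite exprn_gt0.
apply/seteqP; split => x /=.
  move=> <- i; rewrite !mxE/= in_itv/= ler_pdivrMr// ltr_pdivlMr//.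
  by have := floor_itv (2 ^+ k * tnth x i)%R; rewrite intrD mulrC.
move=> h; apply/rowP => i; rewrite !mxE; apply/eqP; rewrite floor_eq.
have := h i; rewrite /= in_itv/= ler_pdivrMr// ltr_pdivlMr//.
by rewrite intrD mulrC.
Qed.

Lemma measurable_cell k m : measurable (grid k @^-1` [set m] : set Tn).
Proof.
rewrite grid_cell; apply: (@measurable_forall_tnth _ _ (fun i => _)) => i.
exact: measurable_itv.
Qed.

Lemma gridE k S :
  grid k @^-1` S = \bigcup_(m in S) (grid k @^-1` [set m]) :> set (Rn R n).
Proof.
apply/seteqP; split => x /=; first by exists (grid k x).
by move=> [m Sm /= ->].
Qed.

Lemma measurable_grid k S : measurable (grid k @^-1` S : set Tn).
Proof.
rewrite gridE bigcup_mkcond; apply: countable_bigcupT_measurable => // m.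
by case: ifP => // _; exact: measurable_cell.
Qed.

(** The bridge between the two settings: up to the factor of one cell volume, measuring a union of
    cells is counting indices. *)
Lemma lebesgue_grid k S :
  lebesgue_Rn (grid k @^-1` S : set (Rn R n)) = ((2 ^- k) ^+ n)%:E * counting S.
Proof.
rewrite gridE; apply: (@measure_bigcup_cst _ _ _ (@lebesgue_Rn R n)).
- by rewrite exprn_gt0// invr_gt0 exprn_gt0.
- apply/trivIsetP => m m' _ _ mm'; rewrite -subset0 => x /= [xm xm'].
  by rewrite -xm -xm' eqxx in mm'.
- by move=> m; apply: measurable_Rn; exact: measurable_cell.
- move=> m; rewrite grid_cell.
  rewrite (_ : (_ ^+ n)%R = \prod_(i < n) 2 ^- k)%R; last first.
    by rewrite prodr_const card_ord.
  apply: (@lebesgue_Rn_prod (fun i => _)) => i; first exact: measurable_itv.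
  rewrite lebesgue_measure_itv/= lte_fin ltr_pM2r ?invr_gt0 ?exprn_gt0//.
  rewrite ltrDl ltr01 -EFinB -mulrBl; congr (_%:E); rewrite addrAC subrr add0r.
  by rewrite mul1r.
Qed.

(** The half-open cube from [1 - L] to [L] in each coordinate, described by cells of level 0 so that
    it is a union of cells at every level. *)
Definition window (L : nat) : set (Rn R n) :=
  grid 0 @^-1` int_box (const_mx (- L%:Z)%R) (const_mx L%:Z).

Lemma window_lty L : lebesgue_Rn (window L) < +oo.
Proof.
apply: (@le_lt_trans _ _ (lebesgue_Rn ([set x : Rn R n | forall i,
    `[(- L%:R)%R, (L%:R + 1)%R]%classic (tnth x i)]))).
  apply: le_lebesgue_Rn => x h i; have := h i.
  rewrite !mxE expr0 mul1r /= in_itv/= => /andP[h1 h2].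
  have /andP[f1 f2] := floor_itv (tnth x i).
  move: h1 h2 f1 f2; rewrite -(ltr_int R) -(ltr_int R) intrD rmorphN/= -!pmulrn.
  by move=> h1 h2 f1 f2; apply/andP; split; lra.
rewrite (@lebesgue_Rn_prod (fun i => _) (fun=> L%:R + 1 + L%:R)%R) ?ltry// => i.
rewrite lebesgue_measure_itv/= lte_fin ifT; last by have := ler0n R L; lra.
by rewrite -EFinB opprK.
Qed.

Lemma near_window (a b : Rn R n) :
  \forall L \near \oo, open_box a b `<=` window L.
Proof.
have h i : \forall L \near \oo,
    (- L%:R + 1 <= tnth a i)%R /\ (tnth b i <= L%:R)%R.
  near=> L; split; near: L.
  - exists (Num.trunc `|1 - tnth a i|%R).+1 => // L /= hL.
    have := truncnS_gt `|1 - tnth a i|%R; rewrite -(ler_nat R) in hL.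
    by have := ler_norm (1 - tnth a i)%R; lra.
  - exists (Num.trunc `|tnth b i|%R).+1 => // L /= hL.
    have := truncnS_gt `|tnth b i|%R; rewrite -(ler_nat R) in hL.
    by have := ler_norm (tnth b i); lra.
near=> L.
have H i : (- L%:R + 1 <= tnth a i)%R /\ (tnth b i <= L%:R)%R.
  by move: i; near: L; exact: filter_forall.
move=> x abx i; have /andP[ax xb] := abx i; have [h1 h2] := H i.
rewrite !mxE expr0 mul1r floor_lt_int -lezD1 floor_ge_int intrD rmorphN/=.
rewrite -!pmulrn.
by apply/andP; split; lra.
Unshelve. all: by end_near. Qed.

End GridMeasure.

(** * Dyadic approximation of measurable sets *)

Lemma measurable_sub_rays (R : realType)
    (G : set (set (measurableTypeR R))) :
  sigma_algebra setT G -> (forall a : R, G `]a, +oo[%classic) ->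
  measurable `<=` G.
Proof.
move=> sG Gray B; rewrite [measurable]measurable_realfun.RGenOInfty.measurableE.
by move: B; apply: smallest_sub => // _ [a ->].
Qed.

Section GridApproximation.
Context {R : realType} {n : nat}.
Local Notation RT := (measurableTypeR R).
Local Notation Tn := (n.-tuple RT).
Implicit Types (k j L : nat) (S : set 'rV[int]_n) (E Q : set (Rn R n)).

Definition grid_sets : set (set (Rn R n)) :=
  [set A | exists k S, A = grid k @^-1` S].

Lemma grid_sets_measurable : grid_sets `<=` measurable.
Proof. by move=> _ [k [S ->]]; exact: measurable_Rn (measurable_grid k S). Qed.

Lemma grid_setsC : setC_closed grid_sets.
Proof. by move=> _ [k [S ->]]; exists k, (~` S). Qed.

Lemma grid_setsU : setU_closed grid_sets.
Proof.
move=> _ _ [k [S ->]] [j [S' ->]].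
have [U ->] := @grid_refine R n _ _ S (leq_maxl k j).
have [U' ->] := @grid_refine R n _ _ S' (leq_maxr k j).
by exists (maxn k j), (U `|` U').
Qed.

Lemma grid_sets0 : grid_sets set0.
Proof. by exists 0%N, set0; rewrite preimage_set0. Qed.

(** Coordinate preimages generate the sigma-algebra of tuples, and rays generate the Borel sets of
    the line, so only half-spaces need treatment. *)
Lemma approximable_borel (A W : set Tn) : measurable A ->
  measurable (W : set (Rn R n)) -> lebesgue_Rn W < +oo ->
  approximable (@lebesgue_Rn R n) grid_sets W A.
Proof.
move=> mA mW Woo.
have sa : sigma_algebra setT (approximable (@lebesgue_Rn R n) grid_sets W).
  apply: approximable_sigma_algebra => //.
  - exact: grid_sets_measurable.
  - exact: grid_setsC.
  - exact: grid_setsU.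
  - exact: grid_sets0.
move: A mA; apply: smallest_sub => //.
apply: (@big_ind _ (fun G => G `<=` _)) => // [G H GS HS|i _ _ [B mB <-]].
  by rewrite subUset.
apply: (@measurable_sub_rays _ (image_set_system setT
    (fun x : Tn => tnth x i) (approximable (@lebesgue_Rn R n) grid_sets W))) => //.
  exact: sigma_algebra_image.
move=> a; rewrite /image_set_system/= setTI.
(* Cells lying strictly beyond the hyperplane at height [a]. Over all levels they fill the open
   half-space, and each [F k] is its own approximation. *)
pose F k := grid k @^-1`
  [set m | (Num.floor (2 ^+ k * a)%R < m ord0 i)%R] : set (Rn R n).
rewrite (_ : _ @^-1` _ = \bigcup_k F k).
  case: sa => _ _; apply => k; split.
    exact: measurable_Rn (measurable_grid _ _).
  move=> e e0; exists (F k); first by exists k; eexists.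
  by rewrite setYK set0I measure0 lte_fin.
apply/seteqP; split => x; rewrite /F/= in_itv/= andbT.
  move=> /near_floor_lt/filter_ex[k kx].
  by exists k => //=; rewrite mxE.
move=> [k _ /=]; rewrite mxE => /floor_lt_inv.
by rewrite ltr_pM2l// exprn_gt0.
Qed.

(** A Borel set [B] around [E] costs [e / 2], and approximating [B] by cells on the window costs
    another [e / 2]. The second bound controls the whole symmetric difference in the window, so one
    [S] serves every [Q]. *)
Lemma grid_approx E k L (e : R) : lebesgue_Rn E < +oo -> (0 < e)%R ->
  exists j S, [/\ (k <= j)%N,
    lebesgue_Rn (grid j @^-1` S : set (Rn R n)) < lebesgue_Rn E + e%:E &
    forall Q, measurable Q -> Q `<=` window L ->
      lebesgue_Rn (E `&` Q) < lebesgue_Rn (grid j @^-1` S `&` Q) + e%:E].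
Proof.
move=> Eoo e0; have e20 : (0 < e / 2)%R by rewrite divr_gt0.
have [B [mB EB Be]] := lebesgue_Rn_outer Eoo e20.
have mW : measurable (window L : set (Rn R n)).
  exact: measurable_Rn (measurable_grid _ _).
have [mB' /(_ _ e20)[F [j0 [S0 FS0]] BF]] :=
  approximable_borel mB mW (window_lty L).
(* Cutting by the window keeps the measure of the cells below that of [E] plus [e]; level
   [maxn k j0] provides [k <= j]. *)
have [S FS] : exists S, grid (maxn k j0) @^-1` S = F `&` window L.
  have [U WU] := @grid_refine R n _ _
    (int_box (const_mx (- L%:Z)%R) (const_mx L%:Z)) (leq0n (maxn k j0)).
  have [U' FU'] := @grid_refine R n _ _ S0 (leq_maxr k j0).
  by exists (U' `&` U); rewrite FS0 FU' /window WU.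
have mF : measurable F by apply: grid_sets_measurable; exists j0, S0.
have mBF : measurable (((B : set (Rn R n)) `+` F) `&` window L).
  apply: measurableI => //; have mBn := measurable_Rn mB.
  by apply: measurableU; exact: measurableD.
exists (maxn k j0), S; rewrite FS leq_maxl; split => //.
  rewrite [e]splitr EFinD addeA; apply: le_lt_trans (lteD Be BF).
  apply: le_trans (measureU2 _ (measurable_Rn mB) mBF).
  apply: le_lebesgue_Rn => x [Fx Wx].
  have [Bx|Bx] := pselect (B x); [by left|right].
  by split=> //; right.
move=> Q mQ QW.
have mFQ : measurable (F `&` window L `&` Q).
  by apply: measurableI => //; exact: measurableI.
apply: (@le_lt_trans _ _ (lebesgue_Rn (F `&` window L `&` Q) +
    lebesgue_Rn ((B `+` F) `&` window L))); last first.
  rewrite lteD2lE; last first.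
    rewrite ge0_fin_numE//; apply: le_lt_trans (window_lty L).
    by apply: le_lebesgue_Rn => x [[]].
  by apply: lt_trans BF _; rewrite lte_fin; lra.
apply: le_trans (measureU2 _ mFQ mBF).
apply: le_lebesgue_Rn => x [/EB Bx Qx].
have Wx := QW _ Qx.
have [Fx|Fx] := pselect (F x); [by left|right].
by split=> //; left.
Qed.

End GridApproximation.

(** * Level sets of the maximal functions; from lattice sets to unions of unit cells *)

Section MaximalLevelSets.
Context {R : realType} {n : nat}.
Implicit Types (a b : Rn R n) (m p q : 'rV[int]_n) (alpha : R).
Local Notation card E := (@counting 'rV[int]_n R E).

(** The inverse of [+oo] is 0 in [\bar R], so a normalisation by an infinite size never gives more
    than [alpha]; hence the finiteness clause. *)
Lemma lt_inve_mull alpha (x y : \bar R) : (0 <= alpha)%R -> 0 < x ->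
  alpha%:E < x^-1 * y <-> x < +oo /\ alpha%:E * x < y.
Proof.
move=> alpha0; case: x => [r| |//].
  rewrite lte_fin => r0; rewrite inver gt_eqF// lte_pdivlMl// muleC ltry.
  by split=> [|[]].
by rewrite invey mul0e; split=> [|[]//]; rewrite lte_fin ltNge alpha0.
Qed.

Lemma strong_maximal_gt alpha (E : set (Rn R n)) (x : Rn R n) :
  measurable E -> (0 <= alpha)%R ->
  alpha%:E < strong_maximal \1_E x <->
  exists a b, open_box a b x /\
    alpha%:E * lebesgue_Rn (open_box a b) < lebesgue_Rn (E `&` open_box a b).
Proof.
move=> mE alpha0.
have avg a b : open_box a b x ->
    alpha%:E < (lebesgue_Rn (open_box a b))^-1 *
      \int[@lebesgue_Rn R n]_(y in open_box a b) `|\1_E y|%:E <->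
    alpha%:E * lebesgue_Rn (open_box a b) < lebesgue_Rn (E `&` open_box a b).
  move=> abx.
  (* A box containing a point has positive sides, hence finite positive volume. *)
  have ab i : (tnth a i < tnth b i)%R by have /andP[] := abx i; exact: lt_trans.
  under eq_integral do rewrite indicE normr_nat -indicE.
  rewrite integral_indic//; last exact: measurable_Rn (measurable_open_box _ _).
  rewrite lt_inve_mull// lebesgue_open_box// ?lte_fin ?ltry; first by split=> [[]|].
  by apply: prodr_gt0 => i _; rewrite subr_gt0.
split.
  move=> /ereal_sup_gt[_ [Q [[a [b ->]] abx] <-]] /(avg _ _ abx) h.
  by exists a, b.
move=> [a [b [abx /(avg _ _ abx) h]]]; apply: lt_le_trans h _.
by apply: ereal_sup_ubound; exists (open_box a b) => //; split=> //; exists a, b.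
Qed.

Definition translate a m : Rn R n :=
  [tuple (tnth a i + (m ord0 i)%:~R)%R | i < n].

Lemma lattice_points_box a b : lattice_points (open_box a b) =
  [set m | forall i, (tnth a i < (m ord0 i)%:~R < tnth b i)%R].
Proof.
by apply/seteqP; split => m h i; have := h i; rewrite /Rn_of_int tnth_mktuple.
Qed.

Lemma lattice_points_translate a b m :
  lattice_points (open_box (translate a m) (translate b m)) =
  (fun j => m + j)%R @` lattice_points (open_box a b).
Proof.
rewrite !lattice_points_box; apply/seteqP; split=> [l h|_ [j h <-] i].
  exists (l - m)%R; last by rewrite addrC subrK.
  by move=> i; have := h i; rewrite !tnth_mktuple !mxE intrD rmorphN/=; lra.
by have := h i; rewrite !tnth_mktuple mxE intrD; lra.
Qed.

(** The discrete operator shifts the function and keeps the box around the origin. Translating the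
    box by [m] instead gives averages over boxes containing [m], as in the continuous case. *)
Lemma discrete_strong_maximal_gt alpha (E : set 'rV[int]_n) m :
  (0 <= alpha)%R ->
  alpha%:E < @discrete_strong_maximal R n \1_E m <->
  exists a b, let K := lattice_points (open_box a b) in
    [/\ K m, card K < +oo & alpha%:E * card K < card (E `&` K)].
Proof.
move=> alpha0.
have avg a b : lattice_points (open_box a b) 0%R ->
    alpha%:E < (card (lattice_points (open_box a b)))^-1 *
      (\esum_(j in lattice_points (open_box a b)) `|\1_E (m + j)%R|%:E) <->
    let K := lattice_points (open_box (translate a m) (translate b m)) in
    card K < +oo /\ alpha%:E * card K < card (E `&` K).
  move=> ab0 /=; set L := lattice_points (open_box a b).
  rewrite lattice_points_translate.
  have -> : E `&` [set (m + j)%R | j in L] =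
      [set (m + j)%R | j in L `&` [set j | E (m + j)%R]].
    apply/seteqP; split=> [x [+ [j Lj jx]]|_ [j [Lj Ej] <-]].
      by rewrite -jx => Ej; exists j.
    by split=> //; exists j.
  rewrite !counting_image; try exact: addrI.
  under eq_esum do rewrite indicE normr_nat.
  rewrite (eq_esum (b := fun j => (\1_[set j | E (m + j)%R] j)%:E)) ?esum_indic;
    last first.
    by move=> j _; rewrite indicE.
  apply: lt_inve_mull => //; apply: (@lt_le_trans _ _ (card [set 0%R])).
    by rewrite counting_esum esum_set1.
  by apply: le_counting => _ ->.
split.
  move=> /ereal_sup_gt[_ [Q [[a [b ->]] ab0] <-]] /(avg _ _ ab0)[h1 h2].
  exists (translate a m), (translate b m); split=> //.
  by rewrite lattice_points_translate; exists 0%R => //; rewrite addr0.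
move=> [a [b [abm h1 h2]]].
have tK (c : Rn R n) : translate (translate c (- m)%R) m = c.
  by apply: eq_from_tnth => i; rewrite !tnth_mktuple mxE rmorphN/= subrK.
have ab0 : lattice_points
    (open_box (translate a (- m)%R) (translate b (- m)%R)) 0%R.
  by rewrite lattice_points_translate; exists m => //; rewrite addrC subrr.
have := avg _ _ ab0; rewrite !tK => -[_ /(_ (conj h1 h2))/lt_le_trans]; apply.
apply: ereal_sup_ubound; eexists; last reflexivity.
by split=> //; eexists; eexists.
Qed.

(** The cell is open in order to fit in an open box with integer corners: [m] itself may lie on the
    boundary of that box. *)
Definition unit_cell m : set (Rn R n) :=
  open_box (Rn_of_int R m) (Rn_of_int R (m + const_mx 1)%R).

Lemma lebesgue_unit_cells (S : set 'rV[int]_n) :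
  lebesgue_Rn (\bigcup_(m in S) unit_cell m) = card S.
Proof.
have ltS m i :
    (tnth (Rn_of_int R m) i < tnth (Rn_of_int R (m + const_mx 1)%R) i)%R.
  by rewrite !tnth_mktuple !mxE intrD ltrDl.
rewrite (@measure_bigcup_cst _ _ _ (@lebesgue_Rn R n) _ _ 1) ?mul1e//.
- apply/trivIsetP => m m' _ _ mm'; rewrite -subset0 => x [xm xm'].
  move: mm' => /eqP; apply; apply/rowP => i.
  have := xm i; have := xm' i; rewrite !tnth_mktuple !mxE.
  move=> /andP[a1 a2] /andP[b1 b2].
  have := lt_trans a1 b2; have := lt_trans b1 a2; rewrite !ltr_int.
  by rewrite !ltzD1 => h1 h2; apply/le_anti; rewrite h1 h2.
- by move=> m; apply: measurable_Rn; exact: measurable_open_box.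
- move=> m; rewrite [LHS]lebesgue_open_box// big1// => i _.
  by rewrite !tnth_mktuple !mxE intrD addrAC subrr add0r.
Qed.

(** The corners [a'] are the least integers above those of [a], and the corners [b'] are one more
    than the greatest integers below those of [b]. *)
Lemma unit_cell_sub_box a b m : lattice_points (open_box a b) m ->
  let a' := [tuple (Num.floor (tnth a i) + 1)%:~R%R | i < n] : Rn R n in
  let b' := [tuple (- Num.floor (- tnth b i))%:~R%R | i < n] : Rn R n in
  unit_cell m `<=` open_box a' b'.
Proof.
rewrite lattice_points_box => abm /= x mx i.
have := mx i; have /andP[am mb] := abm i.
rewrite !tnth_mktuple !mxE => /andP[mx1 mx2].
have am' : (Num.floor (tnth a i) + 1 <= m ord0 i)%R.
  by rewrite lezD1 floor_lt_int.
have mb' : (m ord0 i + 1 <= - Num.floor (- tnth b i))%R.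
  by rewrite lezD1 -[ltLHS]opprK ltrN2 floor_lt_int rmorphN/= ltrN2.
rewrite (le_lt_trans _ mx1) ?ler_int//.
by rewrite (lt_le_trans mx2)// ler_int.
Qed.

(** Through [lebesgue_grid], this bounds the volume of the rounded box by the number of lattice
    points of the original one. *)
Lemma rounded_box_sub_grid a b :
  let a' := [tuple (Num.floor (tnth a i) + 1)%:~R%R | i < n] : Rn R n in
  let b' := [tuple (- Num.floor (- tnth b i))%:~R%R | i < n] : Rn R n in
  open_box a' b' `<=` grid 0 @^-1` lattice_points (open_box a b).
Proof.
rewrite lattice_points_box /= => x abx i; have := abx i.
rewrite !tnth_mktuple !mxE expr0 mul1r.
have /andP[f1 f2] := floor_itv (tnth a i).
have /andP[g1 g2] := floor_itv (- tnth b i)%R.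
have /andP[h1 h2] := floor_itv (tnth x i).
move=> /andP[x1 x2]; apply/andP; split.
  apply: (lt_le_trans f2); rewrite ler_int floor_ge_int; exact: ltW.
move: x2; rewrite rmorphN/= => x2.
have : (Num.floor (tnth x i) + 1 <= - Num.floor (- tnth b i))%R.
  by rewrite lezD1 floor_lt_int rmorphN.
rewrite -(ler_int R) intrD rmorphN/= => h.
by move: g2; rewrite intrD => g2; lra.
Qed.

Lemma discrete_tauberian_le alpha : (0 <= alpha)%R ->
  @discrete_tauberian R n alpha <= tauberian n alpha.
Proof.
move=> alpha0; apply: ge_ereal_sup => _ [E /= E0oo <-].
pose E' : set (Rn R n) := \bigcup_(m in E) unit_cell m.
have mE' : measurable E'.
  apply: measurable_Rn.
  rewrite /E' bigcup_mkcond; apply: countable_bigcupT_measurable => // m.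
  by case: ifP => // _; exact: measurable_open_box.
have cardE : card E = lebesgue_Rn E' by rewrite lebesgue_unit_cells.
rewrite -(lebesgue_unit_cells [set m | _]) cardE.
apply: (@le_trans _ _ ((lebesgue_Rn E')^-1 *
    lebesgue_Rn [set x | alpha%:E < strong_maximal \1_E' x])); last first.
  by apply: ereal_sup_ubound; exists E' => //; split=> //; rewrite -cardE.
apply: lee_wpmul2l; first by rewrite inve_ge0.
apply: le_lebesgue_Rn => x [m /= /(discrete_strong_maximal_gt _ _ alpha0)].
move=> [a [b [Km Koo Kgt]]] mx; apply/strong_maximal_gt => //.
have cellK := @unit_cell_sub_box a b; have Kgrid := @rounded_box_sub_grid a b.
eexists; eexists; split; first exact: (cellK m).
(* With [K] the lattice points of the box, [alpha] times the rounded volume is at most [alpha] times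
   the size of [K], which is less than the number of points of [E] in [K]; their cells lie in both
   [E'] and the rounded box. *)
apply: (@le_lt_trans _ _ (alpha%:E * card (lattice_points (open_box a b)))).
  rewrite lee_wpmul2l ?lee_fin//; apply: le_trans (le_lebesgue_Rn Kgrid) _.
  by rewrite lebesgue_grid expr0 invr1 expr1n mul1e.
apply: (lt_le_trans Kgt); rewrite -lebesgue_unit_cells.
apply: le_lebesgue_Rn => y [l [El Kl] ly]; split; first by exists l.
exact: cellK ly.
Qed.

End MaximalLevelSets.

(** * Continuous level sets bounded through discrete ones *)

Section TauberianUpperBound.
Context {R : realType} {n : nat}.
Context (alpha : R) (alpha0 : (0 <= alpha)%R).
Implicit Types (p q : 'rV[int]_n) (S : set 'rV[int]_n).
Local Notation card E := (@counting 'rV[int]_n R E).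
Local Notation Ct := (@discrete_tauberian R n alpha).

Lemma discrete_tauberian_ge0 : 0 <= Ct.
Proof.
have c1 : card [set 0%R] = 1 by rewrite counting_esum esum_set1.
apply: ereal_sup_ge; eexists.
  by exists [set 0%R] => //; rewrite /= c1 lte01 ltry.
by rewrite mule_ge0 ?inve_ge0 ?counting_ge0.
Qed.

(* [discrete_tauberian] ranges over nonempty sets only. *)
Lemma discrete_weak_type S : card S < +oo ->
  card [set m | alpha%:E < @discrete_strong_maximal R n \1_S m] <= Ct * card S.
Proof.
move=> Soo; have [S0|S0] := eqVneq (card S) 0.
  rewrite S0 mule0 (_ : [set m | _] = set0) ?counting_esum ?esum_set0//.
  rewrite -subset0 => m /= /(discrete_strong_maximal_gt _ _ alpha0).
  move=> [a [b [_ _]]]; rewrite ltNge => /negP; apply.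
  apply: (@le_trans _ _ 0); last by rewrite mule_ge0 ?counting_ge0.
  by rewrite -S0; apply: le_counting; exact: subIsetl.
have Sgt0 : 0 < card S by rewrite lt0e S0 counting_ge0.
have : (card S)^-1 *
    card [set m | alpha%:E < @discrete_strong_maximal R n \1_S m] <= Ct.
  by apply: ereal_sup_ubound; exists S => //=; rewrite Sgt0.
move: Sgt0 Soo; case: (card S) => [r| |//]; last by rewrite ltxx.
by rewrite lte_fin => r0 _; rewrite inver gt_eqF// lee_pdivrMl// muleC.
Qed.

Lemma lattice_points_int_box p q :
  lattice_points (open_box (Rn_of_int R p) (Rn_of_int R q)) = int_box p q.
Proof.
rewrite lattice_points_box; apply/seteqP.
by split => m h i; have := h i; rewrite !tnth_mktuple !ltr_int.
Qed.

Lemma grid_scale_gt0 j : (0 < (2 ^- j) ^+ n :> R)%R.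
Proof. by rewrite exprn_gt0// invr_gt0 exprn_gt0. Qed.

Lemma counting_grid_lty j S :
  lebesgue_Rn (grid j @^-1` S : set (Rn R n)) < +oo -> card S < +oo.
Proof.
rewrite lebesgue_grid [in X in _ -> X]ltey; apply: contraTneq => ->.
by rewrite gt0_muley ?lte_fin ?grid_scale_gt0.
Qed.

Context (E : set (Rn R n)).

(* The gap [2^-k] makes one approximation of [E] serve all the boxes of level
   [k], and decreases with [k] so that these sets of points are nested. *)
Definition good_grid_points k : set 'rV[int]_n :=
  [set l | exists p q, let Q := grid k @^-1` int_box p q in
    [/\ int_box p q l, Q `<=` window k &
      alpha%:E * lebesgue_Rn Q + (2 ^- k)%:E <= lebesgue_Rn (E `&` Q)]].

(** With [S] approximating [E] at a level [j >= k] up to [e <= 2 ^- k], every good box for [E]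
    becomes an integer box at scale [2 ^- j] on which [S] has density above [alpha]. The discrete
    weak-type bound for [S] applies, and [e] tends to 0. *)
Lemma lebesgue_good_grid_points k : 0 < lebesgue_Rn E -> lebesgue_Rn E < +oo ->
  lebesgue_Rn (grid k @^-1` good_grid_points k : set (Rn R n)) <=
  Ct * lebesgue_Rn E.
Proof.
move=> Egt0 Eoo.
have k0 : (0 < 2 ^- k :> R)%R by rewrite invr_gt0 exprn_gt0.
have step (e : R) : (0 < e)%R -> (e <= 2 ^- k)%R ->
    lebesgue_Rn (grid k @^-1` good_grid_points k : set (Rn R n)) <=
    Ct * (lebesgue_Rn E + e%:E).
  move=> e0 ek; have [j [S [kj SE SQ]]] := grid_approx k k Eoo e0.
  have Soo : card S < +oo.
    have : lebesgue_Rn (grid j @^-1` S : set (Rn R n)) < +oo.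
      by apply: lt_trans SE _; rewrite lte_add_pinfty ?ltry.
    exact: counting_grid_lty.
  apply: (@le_trans _ _
    (Ct * lebesgue_Rn (grid j @^-1` S : set (Rn R n)))); last first.
    by apply: lee_wpmul2l; [exact: discrete_tauberian_ge0|exact: ltW].
  apply: (@le_trans _ _ (lebesgue_Rn (grid j @^-1`
      [set m | alpha%:E < @discrete_strong_maximal R n \1_S m] :
      set (Rn R n)))); last first.
    rewrite !lebesgue_grid muleCA; apply: lee_wpmul2l.
      by rewrite lee_fin ltW// grid_scale_gt0.
    exact: discrete_weak_type.
  apply: le_lebesgue_Rn => x [p [q [xpq Qk Qgood]]].
  have [p' [q' QE]] := @grid_refine_box R n _ _ p q kj.
  rewrite QE in Qk Qgood.
  have xpq' : int_box p' q' (grid j x).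
    by have : (grid k @^-1` int_box p q) x by []; rewrite QE.
  have Qfin : lebesgue_Rn (grid j @^-1` int_box p' q' : set (Rn R n)) < +oo.
    exact: le_lt_trans (le_lebesgue_Rn Qk) (window_lty k).
  have Qlt : alpha%:E *
      lebesgue_Rn (grid j @^-1` int_box p' q' : set (Rn R n)) <
      lebesgue_Rn (grid j @^-1` (S `&` int_box p' q') : set (Rn R n)).
    (* The gap [2 ^- k] of the good box absorbs the approximation error [e]. *)
    have := SQ _ (measurable_Rn (measurable_grid j (int_box p' q'))) Qk.
    move=> /(le_lt_trans Qgood).
    rewrite preimage_setI => h; rewrite -(@lteD2rE _ e%:E)//.
    by apply: le_lt_trans h; rewrite leeD2l// lee_fin.
  apply/discrete_strong_maximal_gt => //.
  exists (Rn_of_int R p'), (Rn_of_int R q'); rewrite lattice_points_int_box.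
  split=> //; first exact: counting_grid_lty Qfin.
  (* Dividing by the cell volume turns measures into cardinalities. *)
  by move: Qlt; rewrite !lebesgue_grid muleCA lte_pmul2l// lte_fin grid_scale_gt0.
have Ct0 := discrete_tauberian_ge0; move: Ct0 step.
case: Ct => [c| |//]; last first.
  by move=> _ _; rewrite gt0_mulye// leey.
rewrite lee_fin => c0 step; apply/lee_addgt0Pr => e e0.
have c1 : (0 < c + 1)%R by lra.
(* The denominator [c + 1] instead of [c] covers the case [c = 0]. *)
have m0 : (0 < Num.min (2 ^- k) (e / (c + 1)))%R by rewrite lt_min k0 divr_gt0.
apply: le_trans (step _ m0 _) _; first by rewrite ge_min lexx.
rewrite muleDr//; last by rewrite fin_num_adde_defl.
rewrite leeD2l// -EFinM lee_fin.
apply: (@le_trans _ _ (c * (e / (c + 1)))%R).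
  by rewrite ler_wpM2l// ge_min lexx orbT.
by rewrite mulrA ler_pdivrMr//; nra.
Qed.

(** The same box, rewritten with finer cells, stays good: the window grows and the required gap
    shrinks. *)
Lemma good_grid_pointsS k :
  (grid k @^-1` good_grid_points k : set (Rn R n)) `<=`
  grid k.+1 @^-1` good_grid_points k.+1.
Proof.
move=> x [p [q [xpq Qk Qgood]]].
have [p' [q' QE]] := @grid_refine_box R n _ _ p q (leqnSn k).
exists p', q'; rewrite /= -QE; split.
- by have : (grid k @^-1` int_box p q) x by []; rewrite QE.
- apply: subset_trans Qk _ => y h i; have := h i; rewrite !mxE; lia.
- apply: le_trans Qgood; rewrite leeD2l// lee_fin.
  by rewrite lef_pV2 ?posrE ?exprn_gt0// exprS ler_peMl ?exprn_ge0// ler1n.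
Qed.

Lemma strong_maximal_good (x : Rn R n) : measurable E ->
  alpha%:E < strong_maximal \1_E x ->
  exists k, good_grid_points k (grid k x).
Proof.
move=> mE /(strong_maximal_gt _ mE alpha0)[a [b [abx]]].
have ab i : (tnth a i < tnth b i)%R by have /andP[] := abx i; exact: lt_trans.
have mI k : measurable (inner_box a b k).
  exact: measurable_Rn (measurable_grid _ _).
have cvgI : lebesgue_Rn (E `&` inner_box a b k) @[k --> \oo] -->
    lebesgue_Rn (E `&` open_box a b).
  rewrite -bigcup_inner_box setI_bigcupr.
  apply: (@nondecreasing_cvg_mu _ _ _ (@lebesgue_Rn R n)).
  - by move=> k; exact: measurableI mE (mI k).
  - by apply: bigcupT_measurable => k; exact: measurableI mE (mI k).
  - move=> i j ij; apply/subsetPset; apply: setIS; move: i j ij.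
    apply: (@homo_leq _ _ (fun A B => A `<=` B)) => [A|B A C|].
    + exact: subset_refl.
    + exact: subset_trans.
    + exact: inner_boxS.
set s := lebesgue_Rn (E `&` open_box a b) in cvgI *.
set v := (\prod_(i < n) (tnth b i - tnth a i))%R.
have vE : lebesgue_Rn (open_box a b) = v%:E by rewrite lebesgue_open_box.
have : s <= v%:E by rewrite -vE; apply: le_lebesgue_Rn; exact: subIsetr.
have : 0 <= s by exact: measure_ge0.
rewrite vE -EFinM; move: cvgI; case: s => [s| |]//= cvgI _ _.
rewrite lte_fin => vs.
(* Half of the surplus [s - alpha * v] pays for passing to the inner box, the other half for the gap
   [2 ^- k]. *)
have mid : (alpha * v < (alpha * v + s) / 2 < s)%R by apply/andP; split; lra.
have /filter_ex[k [[hwin xk] [hI hk]]] : \forall k \near \oo,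
    (open_box a b `<=` window k /\ inner_box a b k x) /\
    (((alpha * v + s) / 2)%:E < lebesgue_Rn (E `&` inner_box a b k) /\
    (((s - alpha * v) / 2)^-1 < 2 ^+ k)%R).
  near=> k; split; split; near: k.
  - exact: near_window.
  - exact: near_inner_box.
  - apply: (cvgI [set y | ((alpha * v + s) / 2)%:E < y]); apply: open_nbhs_nbhs.
    by split; [exact: open_ereal_gt_ereal|rewrite /= lte_fin; case/andP: mid].
  - by near=> k; apply: upper_nthrootP; near: k; exact: nbhs_infty_ge.
exists k, (grid k a), (grid k b); split=> //.
  by apply: subset_trans hwin; exact: inner_box_sub.
apply: le_trans (ltW hI).
apply: (@le_trans _ _ ((alpha * v)%:E + (2 ^- k)%:E)).
  rewrite leeD2r// EFinM lee_wpmul2l ?lee_fin// -vE.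
  by apply: le_lebesgue_Rn; exact: inner_box_sub.
rewrite -EFinD lee_fin.
have : (2 ^- k <= (s - alpha * v) / 2)%R.
  by rewrite -[leRHS]invrK lef_pV2 ?posrE ?invr_gt0 ?exprn_gt0 ?ltW//; lra.
by lra.
Unshelve. all: by end_near. Qed.

(** The sets [H k] increase and cover the level set, so their uniform bound passes to the union by
    continuity from below. *)
Lemma strong_maximal_weak_type : measurable E ->
  0 < lebesgue_Rn E -> lebesgue_Rn E < +oo ->
  lebesgue_Rn [set x | alpha%:E < strong_maximal \1_E x] <= Ct * lebesgue_Rn E.
Proof.
move=> mE Egt0 Eoo; pose H k : set (Rn R n) := grid k @^-1` good_grid_points k.
apply: (@le_trans _ _ (lebesgue_Rn (\bigcup_k H k))).
  by apply: le_lebesgue_Rn => x /(strong_maximal_good mE)[k]; exists k.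
have mH k : measurable (H k) by exact: measurable_Rn (measurable_grid _ _).
have cvgH : lebesgue_Rn (H k) @[k --> \oo] --> lebesgue_Rn (\bigcup_k H k).
  apply: (@nondecreasing_cvg_mu _ _ _ (@lebesgue_Rn R n)) => //.
    exact: bigcupT_measurable.
  move=> i j ij; apply/subsetPset; move: i j ij.
  apply: (@homo_leq _ _ (fun A B => A `<=` B)) => [A|B A C|].
  - exact: subset_refl.
  - exact: subset_trans.
  - exact: good_grid_pointsS.
rewrite -(cvg_lim _ cvgH)//; apply: lime_le.
  by apply/cvg_ex; eexists; exact: cvgH.
by apply: nearW => k; exact: lebesgue_good_grid_points.
Qed.

End TauberianUpperBound.

Lemma tauberian_le (R : realType) (n : nat) (alpha : R) : (0 <= alpha)%R ->
  tauberian n alpha <= discrete_tauberian n alpha.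
Proof.
move=> alpha0; apply: ge_ereal_sup => _ [E [mE /andP[E0 Eoo]] <-].
have := strong_maximal_weak_type alpha0 mE E0 Eoo.
move: E0 Eoo; case: (lebesgue_Rn E) => [r| |//]; last by rewrite ltxx.
by rewrite lte_fin => r0 _ h; rewrite inver gt_eqF// lee_pdivrMl// muleC.
Qed.

Theorem lemma1 (R : realType) (n : nat) (alpha : R)
    (hn : (1 <= n)%N) (halpha : (0 < alpha < 1)%R) :
  discrete_tauberian n alpha = tauberian n alpha.
Proof.
have alpha0 : (0 <= alpha)%R by case/andP: halpha => /ltW.
by apply/le_anti; rewrite discrete_tauberian_le//= tauberian_le.
Qed.
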